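(* Let $G$ be a finite graph on $n$ vertices with grundy number $\chi_g(G)$, and let $k$ be an integer with $k \geq \chi_g(G)+1$. Then $G$ is $k$-mixing, and the $k$-recoloring diameter of $G$ is at most $4 \cdot \chi_g(G) \cdot n$.
   Context: A (proper) $k$-coloring of $G=(V,E)$ is a map $f:V\to\{1,\dots,k\}$ with $f(x)\neq f(y)$ for every edge $xy$. Two $k$-colorings are adjacent if they differ on exactly one vertex. The $k$-recoloring graph $R_k(G)$ has the proper $k$-colorings of $G$ as vertices (colorings equal up to permutation of colors are distinct vertices), with the adjacency just defined. $G$ is $k$-mixing if $R_k(G)$ is connected; the $k$-recoloring diameter of a $k$-mixing graph is the diameter of $R_k(G)$. For an ordering $x_1,\dots,x_n$ of $V$, the greedy coloring assigns to each $x_i$ in turn the smallest positive integer not used on $N(x_i)\cap\{x_1,\dots,x_{i-1}\}$. The grundy number $\chi_g(G)$ is the maximum, over all orderings of $V$, of the number of colors used by the greedy coloring. *)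

(* Defs.v *)
From mathcomp Require Import all_boot.

Set Implicit Arguments.
Unset Strict Implicit.
Unset Printing Implicit Defensive.

Record sgraph := SGraph {
  vertex :> finType;
  edge : rel vertex;
  edge_sym : symmetric edge;
  edge_irrefl : irreflexive edge
}.

(* As usual, the graph with no vertices is not connected. *)
Definition connected (G : sgraph) : bool :=
  (0 < #|G|) && [forall x : G, forall y : G, connect (@edge G) x y].

Definition walk_of_length (G : sgraph) (x y : G) (m : nat) : bool :=
  [exists p : m.-tuple G, path (@edge G) x p && (last x p == y)].

(* The least m with a walk of length m from x to y. Such an m is smaller than
   #|G| whenever x and y are in the same component; otherwise the value is the
   out-of-range #|G|. *)
Definition dist (G : sgraph) (x y : G) : nat :=
  find (walk_of_length x y) (iota 0 #|G|).

Definition diameter (G : sgraph) : nat :=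
  \max_(x : G) \max_(y : G) dist x y.

Section Recoloring.

Variables (G : sgraph) (k : nat).

(* The k colors 1, ..., k are represented by the k elements of 'I_k. *)
Definition proper_coloring (f : {ffun G -> 'I_k}) : bool :=
  [forall x : G, forall y : G, edge x y ==> (f x != f y)].

Definition coloring : finType := {f : {ffun G -> 'I_k} | proper_coloring f}.

Definition recolor (f g : coloring) : bool :=
  #|[set x : G | val f x != val g x]| == 1.

Lemma recolor_sym : symmetric recolor.
Proof.
move=> f g; congr (_ == _); apply: eq_card => x.
by rewrite !inE eq_sym.
Qed.

Lemma recolor_irrefl : irreflexive recolor.
Proof.
move=> f; rewrite /recolor.
suff -> : [set x : G | val f x != val f x] = set0 by rewrite cards0.
by apply/setP=> x; rewrite !inE eqxx.
Qed.

Definition recoloring_graph : sgraph := SGraph recolor_sym recolor_irrefl.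

Definition mixing : bool := connected recoloring_graph.

Definition recoloring_diameter : nat := diameter recoloring_graph.

End Recoloring.

Lemma ex_free_color (s : seq nat) : exists c, (0 < c) && (c \notin s).
Proof.
exists (\max_(i <- s) i).+1; apply/negP => s_max.
by have := @leq_bigmax_seq _ s xpredT id _ s_max isT; rewrite /= ltnn.
Qed.

Definition least_free_color (s : seq nat) : nat := ex_minn (ex_free_color s).

(* Colors the vertices of s in turn; vertices not colored yet carry the value 0,
   which is not a positive integer and so never constrains the choice. *)
Definition greedy (G : sgraph) (s : seq G) : G -> nat :=
  foldl (fun (c : G -> nat) x =>
           [eta c with x |-> least_free_color [seq c y | y in edge x]])
        (fun=> 0) s.

(* Orderings of the vertices are the duplicate-free tuples of length #|G|. *)
Definition grundy (G : sgraph) : nat :=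
  \max_(s : #|G|.-tuple G | uniq s) size (undup (codom (greedy s))).

(* Main.v *)
Require Import Defs.
From mathcomp Require Import all_boot.

Set Implicit Arguments.
Unset Strict Implicit.
Unset Printing Implicit Defensive.

(** Fix a maximal independent set S of G. From any k-coloring, recoloring the
vertices greedily by increasing color costs at most n steps and leaves a
coloring that uses at most grundy(G) < k colors, so that the top color is free
and S can be given that color in at most n further steps. Since S dominates the
remaining vertices, removing it decreases the grundy number, so the argument
can be repeated on G - S with one color less. After at most grundy(G) rounds
the coloring reached does not depend on the initial one; joining two colorings
through it costs at most twice 2 * grundy(G) * n steps. *)

(** * Walks of bounded length in a graph *)

Section Reach.
Variable T : sgraph.
Implicit Types f g h : T.

Definition reach m f g : Prop :=
  exists p, [/\ path (@edge T) f p, last f p = g & size p <= m].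

Lemma reach0 f : reach 0 f f.
Proof. by exists [::]. Qed.

Lemma reach_edge f g : edge f g -> reach 1 f g.
Proof. by move=> fg; exists [:: g]; rewrite /= fg. Qed.

Lemma reach_leq m m' f g : m <= m' -> reach m f g -> reach m' f g.
Proof. by move=> le_m [p [pp lp sp]]; exists p; split=> //; apply: leq_trans le_m. Qed.

Lemma reach_trans m m' f g h : reach m f g -> reach m' g h -> reach (m + m') f h.
Proof.
move=> [p [pp lp sp]] [p' [pp' lp' sp']]; exists (p ++ p').
by rewrite cat_path last_cat lp pp size_cat leq_add.
Qed.

Lemma reach_sym m f g : reach m f g -> reach m g f.
Proof.
move=> [p [pp <- sp]]; exists (rev (belast f p)).
rewrite size_rev size_belast; split=> //.
  by rewrite rev_path (eq_path (e' := @edge T)) // => x y; rewrite edge_sym.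
by case: p {pp sp} => //= a p; rewrite rev_cons last_rcons.
Qed.

Lemma reach_connect m f g : reach m f g -> connect (@edge T) f g.
Proof. by move=> [p [pp <- _]]; apply/connectP; exists p. Qed.

(** Shortcutting the walk to a duplicate-free path makes it shorter than [#|T|], so its length lies
    in the range searched by [dist] and bounds the first hit. *)
Lemma reach_dist m f g : reach m f g -> dist f g <= m.
Proof.
move=> [p [pp lp sp]]; move: lp; case/shortenP: pp => p' pp' up' sub lp.
have sp' : size p' <= m.
  by apply: leq_trans sp; case/andP: up' => _ up'; apply: uniq_leq_size.
apply: leq_trans sp'.
have lt_p' : size p' < #|T|.
  by rewrite -[(size p').+1]/(size (f :: p')) -(card_uniqP up') max_card.
rewrite leqNgt; apply/negP => /(before_find 0).
rewrite nth_iota // add0n => /negbT/negP[]; apply/existsP; exists (in_tuple p').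
by rewrite pp' lp eqxx.
Qed.

End Reach.

(** * Grundy colorings of induced subgraphs *)

Section Grundy.
Variable G : sgraph.
Implicit Types (A B S : {set G}) (c : G -> nat) (x y : G).

(* Colors start at 0 here, at 1 in [greedy]. *)
Definition grundy_on A c : Prop :=
  (forall x y, x \in A -> y \in A -> edge x y -> c x != c y) /\
  (forall x j, x \in A -> j < c x -> exists y, [/\ y \in A, edge x y & c y = j]).

(** This bounds the grundy number of the subgraph induced by [A]. Using colorings instead of
    orderings makes it easy to pass from [A] to a subset. *)
Definition grundy_bounded A t : Prop :=
  forall c, grundy_on A c -> forall x, x \in A -> c x < t.

Definition independent S := [forall x in S, forall y in S, ~~ edge x y].

Lemma greedy_rcons (s : seq G) x :
  greedy (rcons s x) =
  [eta greedy s with x |-> least_free_color [seq greedy s y | y in edge x]].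
Proof. by rewrite /greedy foldl_rcons. Qed.

(** When vertices are treated by nondecreasing [c], every neighbor witnessing a smaller color
    precedes [x], so greedy is forced to reproduce [c], shifted by one. The closure hypothesis on
    [s] describes the prefixes of such an ordering that may split only the last color class. *)
Lemma greedy_grundy_on c (s : seq G) :
    grundy_on setT c -> pairwise (relpre c leq) s ->
    (forall x y, x \in s -> c y < c x -> y \in s) ->
  forall x, greedy s x = if x \in s then (c x).+1 else 0.
Proof.
move=> [c_proper c_grundy]; elim/last_ind: s => [|s x IH] //.
rewrite pairwise_rcons => /andP[/allP le_x pw_s] closed_s y.
have {}IH : forall z, greedy s z = if z \in s then (c z).+1 else 0.
  apply: IH => // u v us lt_vu.
  have := closed_s u v; rewrite !mem_rcons !inE us orbT => /(_ isT lt_vu).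
  case/predU1P => // def_v; move: (le_x _ us).
  by rewrite /= -def_v leqNgt lt_vu.
rewrite greedy_rcons /= mem_rcons inE; case: eqP => //= ->{y}.
rewrite /least_free_color; case: ex_minnP => m /andP[m_gt0 m_free] m_min.
(* Properness makes [(c x).+1] free; conversely, each smaller positive color is blocked by a
   neighbor already treated. *)
apply/eqP; rewrite eqn_leq; apply/andP; split.
  apply: m_min => /=; apply/negP => /mapP[y]; rewrite mem_enum => xy.
  rewrite IH; case: ifP => // _ [] eq_c.
  by have := c_proper x y (in_setT _) (in_setT _) xy; rewrite eq_c eqxx.
rewrite leqNgt; apply/negP; rewrite ltnS => le_m.
have [|y [_ xy def_y]] := c_grundy x m.-1 (in_setT _); first by rewrite prednK.
case/negP: m_free; apply/mapP; exists y; first by rewrite mem_enum.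
have lt_y : c y < c x by rewrite def_y prednK.
have := closed_s x y; rewrite !mem_rcons !inE eqxx => /(_ isT lt_y).
rewrite IH; case/predU1P => [eq_y|->]; last by rewrite def_y prednK.
by move: lt_y; rewrite eq_y ltnn.
Qed.

(** Sorting the vertices by [c] gives an ordering on which greedy uses all the colors 1, ...,
    [c x + 1]. *)
Lemma grundy_bounded_grundy : grundy_bounded setT (grundy G).
Proof.
move=> c gr_c x _.
pose s := sort (relpre c leq) (enum G).
have mem_s y : y \in s by rewrite mem_sort mem_enum.
have greedyE y : greedy s y = (c y).+1.
  rewrite (greedy_grundy_on gr_c) ?mem_s // -sorted_pairwise.
    by apply: sort_sorted => u v; apply: leq_total.
  by move=> u v w; apply: leq_trans.
have size_s : size s == #|G| by rewrite size_sort cardE.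
have uniq_s : uniq (Tuple size_s) by rewrite /= sort_uniq enum_uniq.
apply: leq_trans (leq_bigmax_cond (Tuple size_s) uniq_s).
rewrite -[(c x).+1](size_iota 1); apply: uniq_leq_size (iota_uniq _ _) _ => j.
rewrite mem_iota mem_undup add1n ltnS => /andP[j_gt0 le_j].
have [y def_j] : exists y, (c y).+1 = j.
  case: (ltngtP j (c x).+1) le_j => // [lt_j|->] _; last by exists x.
  case: gr_c => _ /(_ x j.-1 (in_setT _)) [|y [_ _ def_y]].
    by rewrite prednK.
  by exists y; rewrite def_y prednK.
by rewrite -def_j -greedyE codom_f.
Qed.

Lemma ex_dominating_independent A : exists S,
  [/\ S \subset A, independent S &
      forall x, x \in A :\: S -> exists2 y, y \in S & edge x y].
Proof.
pose P S := (S \subset A) && independent S.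
have P0 : P set0.
  by rewrite /P sub0set; apply/forall_inP => x; rewrite inE.
have [S /maxsetP[/andP[sSA indS] maxS] _] := maxset_exists P0.
exists S; split=> // x; rewrite inE => /andP[xS xA].
case: (boolP [exists y in S, edge x y]) => [/exists_inP[y]|]; first by exists y.
(* Without a neighbor in [S], [x] could be added to [S], against maximality. *)
rewrite negb_exists_in => /forall_inP nS; case/negP: xS.
rewrite -(maxS (x |: S)) ?setU11 ?subsetUr // /P subUset sub1set xA sSA.
apply/forall_inP => u /setU1P uS; apply/forall_inP => v /setU1P vS.
case: uS vS => [->|uS] [->|vS]; rewrite ?edge_irrefl //; first exact: nS.
  by rewrite edge_sym; apply: nS.
by move/forall_inP: indS => /(_ _ uS) /forall_inP; apply.
Qed.

(** A Grundy coloring of [A :\: S] extends to one of [A]: shift it up by one and give color 0 to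
    [S]. Independence keeps it proper, and domination supplies the neighbors of color 0. *)
Lemma grundy_boundedD A S t :
    S \subset A -> independent S ->
    (forall x, x \in A :\: S -> exists2 y, y \in S & edge x y) ->
  grundy_bounded A t.+1 -> grundy_bounded (A :\: S) t.
Proof.
move=> sSA indS domS bA c [c_proper c_grundy] x xAS.
pose c' y := if y \in S then 0 else (c y).+1.
have gr_c' : grundy_on A c'.
  split=> [u v uA vA uv | u j uA]; rewrite /c'.
    case: (boolP (u \in S)) (boolP (v \in S)) => [uS|uS] [vS|vS] //.
      by move/forall_inP: indS => /(_ _ uS) /forall_inP /(_ _ vS); rewrite uv.
    by rewrite eqSS; apply: c_proper; rewrite // inE ?uS ?vS.
  case: (boolP (u \in S)) => // uS; have uAS : u \in A :\: S by rewrite inE uS.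
  case: j => [_|j]; rewrite ?ltnS.
    have [y yS uy] := domS _ uAS.
    by exists y; rewrite yS (subsetP sSA).
  move=> lt_j; have [y [/setDP[yA yS] uy def_y]] := c_grundy u j uAS lt_j.
  by exists y; rewrite yA uy (negbTE yS) def_y.
case/setDP: xAS => xA xS.
by have := bA _ gr_c' _ xA; rewrite /c' (negbTE xS) ltnS.
Qed.

End Grundy.

(** * Recoloring sequences and a common target *)

Section Recoloring.
Variables (G : sgraph) (k : nat).
Implicit Types (A B S : {set G}) (f g h : coloring G k) (d : 'I_k) (x y : G).

Lemma coloring_proper f x y : edge x y -> val f x != val f y.
Proof. by move: (valP f) => /forallP/(_ x)/forallP/(_ y)/implyP; apply. Qed.

Lemma reach_update f g x :
  (forall y, y != x -> val g y = val f y) -> @reach (recoloring_graph G k) 1 f g.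
Proof.
move=> eq_fg; case: (eqVneq (val g x) (val f x)) => [eq_x|neq_x].
  suff -> : g = f by apply: reach_leq (reach0 _).
  by apply/val_inj/ffunP => y; case: (eqVneq y x) => [->|/eq_fg].
apply: reach_edge; apply/cards1P; exists x; apply/setP => y.
rewrite !inE; case: (eqVneq y x) => [->|/eq_fg ->]; last by rewrite eqxx.
by rewrite eq_sym.
Qed.

(** The vertices of [S] can switch to [d] one at a time: no two of them are adjacent, and [d]
    appears nowhere else. *)
Lemma reach_fill S d f :
    independent S -> (forall x, val f x != d) ->
  exists g, @reach (recoloring_graph G k) #|S| f g /\
            forall x, val g x = if x \in S then d else val f x.
Proof.
have [n le_n] := ubnP #|S|; elim: n S le_n => // n IH S le_n indS f_free.
have [->|[x xS]] := set_0Vmem S.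
  by exists f; rewrite cards0; split=> [|x]; [apply: reach0 | rewrite inE].
have indS' : independent (S :\ x).
  apply/forall_inP => u /setD1P[_ uS]; apply/forall_inP => v /setD1P[_ vS].
  by move/forall_inP: indS => /(_ _ uS) /forall_inP; apply.
rewrite (cardsD1 x) xS add1n ltnS in le_n.
have [g [rg gE]] := IH _ le_n indS' f_free.
pose w : {ffun G -> 'I_k} := [ffun y => if y \in S then d else val f y].
have w_proper : proper_coloring w.
  apply/forallP => u; apply/forallP => v; apply/implyP => uv; rewrite !ffunE.
  case: (boolP (u \in S)) (boolP (v \in S)) => [uS|uS] [vS|vS] //.
  - by move/forall_inP: indS => /(_ _ uS) /forall_inP /(_ _ vS); rewrite uv.
  - by rewrite eq_sym.
  - exact: coloring_proper.
exists (exist _ w w_proper); split=> [|y]; last by rewrite ffunE.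
rewrite (cardsD1 x) xS addnC; apply: reach_trans rg _.
apply: (@reach_update _ _ x) => y neq_y.
by rewrite /= ffunE gE !inE neq_y.
Qed.

(* Recoloring by increasing color keeps every intermediate coloring proper: the
   new color of a vertex is at most its old one, which is at most the color of
   every vertex not treated yet. *)
Lemma reach_grundy_on_partial A q f m :
    (forall x, (val f x < q) = (x \in A)) -> m <= #|A| ->
  exists B g, [/\ B \subset A /\ #|B| = m, @reach (recoloring_graph G k) m f g,
    grundy_on B (fun x => val g x : nat),
    forall x, x \notin B -> val g x = val f x &
    forall x y, x \in B -> y \in A :\: B -> val f x <= val f y].
Proof.
move=> fA; elim: m => [_|m IH lt_m].
  exists set0, f; split; rewrite ?sub0set ?cards0 //; first exact: reach0.
    by split=> x ?; rewrite inE.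
  by move=> x y; rewrite inE.
have [B [g [[sBA card_B] rg [g_proper g_grundy] g_off le_f]]] := IH (ltnW lt_m).
have [z0 z0AB] : exists z, z \in A :\: B.
  apply/set0Pn; rewrite -card_gt0 cardsD (setIidPr sBA) card_B.
  by rewrite subn_gt0.
case: (arg_minnP (fun z => val f z : nat) z0AB) => z /setDP[zA zB] min_z.
have gz : val g z = val f z by apply: g_off.
(* Only treated neighbors block a color; the old color of [z] is not blocked, so the least free one
   is at most that. *)
pose used (j : nat) := [exists y in B, edge z y && (val g y == j :> nat)].
have z_free : ~~ used (val f z).
  apply/exists_inP => -[y yB /andP[zy /eqP eq_y]].
  have := coloring_proper g zy; rewrite gz => /eqP[].
  by apply: val_inj; rewrite /= eq_y.
have ex_free : exists j, ~~ used j by exists (val f z).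
have [d d_free d_min] := ex_minnP ex_free.
have le_d : d <= val f z by apply: d_min.
have lt_d : d < k by apply: leq_ltn_trans le_d (ltn_ord _).
pose w : {ffun G -> 'I_k} := [ffun y => if y == z then Ordinal lt_d else val g y].
have d_ok v : edge z v -> Ordinal lt_d != val g v.
  move=> zv; apply/eqP => eq_d; have eq_dn : val g v = d :> nat by rewrite -eq_d.
  case: (boolP (v \in B)) => [vB|vB].
    by case/negP: d_free; apply/exists_inP; exists v; rewrite // zv eq_dn /=.
  (* An untreated neighbor [v] of color [d] would lie in [A], since [d < q]. Minimality of [z] then
     gives [v] the same color as [z] under [f], which is proper. *)
  move: eq_dn; rewrite g_off // => eq_dn.
  have := coloring_proper f zv => /eqP; apply; apply/val_inj/eqP.
  rewrite eqn_leq /= eq_dn le_d andbT.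
  have vA : v \in A by rewrite -fA eq_dn (leq_ltn_trans le_d) // fA.
  by rewrite -eq_dn; apply: min_z; apply/setDP.
have w_proper : proper_coloring w.
  apply/forallP => u; apply/forallP => v; apply/implyP => uv; rewrite !ffunE.
  case: (eqVneq u z) (eqVneq v z) => [eq_u|_] [eq_v|_].
  - by rewrite eq_u eq_v edge_irrefl in uv.
  - by apply: d_ok; rewrite -eq_u.
  - by rewrite eq_sym; apply: d_ok; rewrite -eq_v edge_sym.
  - exact: coloring_proper.
exists (z |: B), (exist _ w w_proper); split.
- by rewrite subUset sub1set zA cardsU1 zB card_B.
- rewrite -addn1; apply: reach_trans rg _.
  by apply: (@reach_update _ _ z) => y neq_y; rewrite /= ffunE (negbTE neq_y).
- split=> [u v _ _ uv|u j]; first exact: (@coloring_proper (exist _ w w_proper)).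
  have wB y : y \in B -> w y = val g y.
    by rewrite ffunE; case: eqP => // ->; rewrite (negbTE zB).
  case/setU1P => [->|uB]; rewrite [val _]/=.
    rewrite {1}ffunE eqxx /= => lt_j.
    have /negPn /exists_inP[y yB /andP[zy /eqP eq_y]] : ~~ ~~ used j.
      by apply/negP => /d_min; rewrite leqNgt lt_j.
    by exists y; rewrite wB // !inE yB orbT.
  rewrite wB // => lt_j; have [y [yB uy eq_y]] := g_grundy u j uB lt_j.
  by exists y; rewrite wB // !inE yB orbT.
- move=> y; rewrite !inE negb_or => /andP[neq_y yB].
  by rewrite /= ffunE (negbTE neq_y) g_off.
- move=> u v uB; rewrite !inE negb_or -andbA => /and3P[neq_v vB vA].
  have vAB : v \in A :\: B by rewrite inE vB.
  by case/setU1P: uB => [->|uB]; [apply: min_z | apply: le_f].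
Qed.

Lemma reach_grundy_on A q f :
    (forall x, (val f x < q) = (x \in A)) ->
  exists g, [/\ @reach (recoloring_graph G k) #|G| f g,
    grundy_on A (fun x => val g x : nat) &
    forall x, x \notin A -> val g x = val f x].
Proof.
move=> fA; have [B [g [[sBA cB] rg gr_g g_off _]]] :=
  reach_grundy_on_partial fA (leqnn _).
have eqBA : B = A by apply/eqP; rewrite eqEcard sBA cB /=.
rewrite eqBA in gr_g g_off; exists g; split=> //.
by apply: reach_leq rg; apply: max_card.
Qed.

(** The vertices outside [A] are frozen with colors at least [q], and [A] uses the colors below [q].
    Each round lowers both [t] and [q] by one, which preserves [t < q]. The target [w] is chosen
    before [f], so it serves all such colorings at once. *)
Lemma reach_common_target t A q :
    grundy_bounded A t -> t < q -> q <= k ->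
  exists w : {ffun G -> 'I_k}, forall f, (forall x, (val f x < q) = (x \in A)) ->
  exists g, @reach (recoloring_graph G k) (2 * t * #|G|) f g /\
            forall x, val g x = if x \in A then w x else val f x.
Proof.
elim: t A q => [|t IH] A [//|q] bA lt_t le_q; pose top := Ordinal le_q.
  (* For [t = 0] the set [A] is empty, as any Grundy coloring of it would have colors below 0; [top]
     is a dummy value. *)
  exists [ffun=> top] => f fA; exists f; split=> [|x]; first exact: reach0.
  case: ifP => // xA; have [g [_ gr_g _]] := reach_grundy_on fA.
  by have := bA _ gr_g _ xA.
have [S [sSA indS domS]] := ex_dominating_independent A.
have [w wP] := IH _ q (grundy_boundedD sSA indS domS bA) lt_t (ltnW le_q).
exists [ffun x => if x \in S then top else w x] => f fA.
have [g [rg gr_g g_off]] := reach_grundy_on fA.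
have g_lt x : x \in A -> val g x < q.
  by move=> xA; apply: leq_trans (bA _ gr_g _ xA) lt_t.
have g_gt x : x \notin A -> q < val g x.
  by move=> xA; rewrite g_off // ltnNge -ltnS fA.
have g_free x : val g x != top.
  apply/eqP => /(congr1 (@nat_of_ord k)) /= eq_x.
  by case: (boolP (x \in A)) => [/g_lt|/g_gt]; rewrite eq_x ltnn.
have [g' [rg' g'E]] := reach_fill indS g_free.
have [x|h [rh hE]] := wP g'.
  rewrite g'E inE; case: ifP => xS; first by rewrite /= ltnn.
  case: (boolP (x \in A)) => [/g_lt //|/g_gt lt_x].
  by apply/negbTE; rewrite -leqNgt ltnW.
exists h; split=> [|x].
  apply: reach_leq (reach_trans rg (reach_trans rg' rh)).
  (* One round costs [#|G|] steps for the Grundy recoloring and [#|S|], at most [#|G|], for the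
     filling. *)
  by rewrite mulnS mulnDl addnA leq_add2r mul2n -addnn leq_add2l max_card.
rewrite hE g'E ffunE inE; case: (boolP (x \in S)) => [xS|xS] /=.
  by rewrite (subsetP sSA).
by case: ifPn => // /g_off.
Qed.

End Recoloring.

(** Since [connected] excludes the empty graph, some coloring must be exhibited: the injective
    coloring by [enum_rank] is recolored to a Grundy one, whose colors are below [grundy G]. *)
Lemma ex_coloring (G : sgraph) (k : nat) :
  grundy G < k -> exists f : coloring G k, true.
Proof.
move=> lt_k; pose r : {ffun G -> 'I_#|G|} := [ffun x => enum_rank x].
have r_proper : proper_coloring r.
  apply/forallP => x; apply/forallP => y; apply/implyP => xy; rewrite !ffunE.
  by apply: contraTneq xy => /enum_rank_inj ->; rewrite edge_irrefl.
have [|g [_ gr_g _]] :=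
    @reach_grundy_on G #|G| setT #|G| (exist _ r r_proper).
  by move=> x; rewrite inE ltn_ord.
have lt_g x : val g x < k.
  exact: ltn_trans (grundy_bounded_grundy gr_g (in_setT x)) lt_k.
pose w : {ffun G -> 'I_k} := [ffun x => Ordinal (lt_g x)].
suff w_proper : proper_coloring w by exists (exist _ w w_proper).
apply/forallP => x; apply/forallP => y; apply/implyP => xy; rewrite !ffunE.
by rewrite -val_eqE /=; apply: coloring_proper.
Qed.

Theorem theorem1 (G : sgraph) (k : nat) (hk : grundy G + 1 <= k) :
  mixing G k /\ recoloring_diameter G k <= 4 * grundy G * #|G|.
Proof.
rewrite addn1 in hk.
have [w wP] := reach_common_target (@grundy_bounded_grundy G) hk (leqnn k).
have reachP (f g : recoloring_graph G k) : reach (4 * grundy G * #|G|) f g.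
  have [x|f' [rf f'E]] := wP f; first by rewrite inE ltn_ord.
  have [x|g' [rg g'E]] := wP g; first by rewrite inE ltn_ord.
  (* With [A] the whole vertex set nothing is frozen, so both colorings reach [w] itself. *)
  have eq_fg : f' = g' by apply/val_inj/ffunP => x; rewrite f'E g'E !inE.
  rewrite -[4]/(2 + 2) 2!mulnDl; apply: reach_trans rf _.
  by rewrite eq_fg; apply: reach_sym.
split.
  apply/andP; split; first by have [f _] := ex_coloring hk; apply/card_gt0P; exists f.
  by apply/forallP => f; apply/forallP => g; apply: reach_connect (reachP f g).
apply/bigmax_leqP => f _; apply/bigmax_leqP => g _.
exact: reach_dist (reachP f g).
Qed.
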